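(* Let $k\ge 1$ be an integer, let $G_k=G(k+(k+1)i)$ be the dense Gaussian network with graph distance $d$, let $S$ be a node of $G_k$, and let $F$ be a set of one or two nodes of $G_k$ (the faulty nodes) with $S\notin F$. Then there exists a node $NS$ of $G_k$ with $d(NS,f)=k$ for every $f\in F$. Moreover, for every such $NS$: (i) no node of $F$ is an internal node of a shortest path from $S$ to $NS$, and $d(S,NS)\le k$, so that the message can be sent from $S$ to $NS$ along any shortest path in at most $k$ steps; (ii) the standard one-to-all broadcast started from $NS$, with the nodes of $F$ faulty, delivers the message to every node of $G_k$ not in $F$ within $k$ parallel steps. Consequently the re-rooted broadcast (relocation from $S$ to $NS$ followed by the standard one-to-all broadcast from $NS$) delivers the message to all non-faulty nodes in at most $2k$ steps in total.
   Context: For an integer $k\ge 1$ put $\pi=k+(k+1)i\in\mathbb{Z}[i]$. The dense Gaussian network $G_k=G(\pi)$ is the undirected graph whose vertex (node) set is the set of residue classes $\mathbb{Z}[i]_\pi=\mathbb{Z}[i]/(\pi)$, and in which two vertices $\alpha,\beta$ are adjacent if and only if $\beta-\alpha\equiv \pm1$ or $\pm i \pmod \pi$. The distance $d(u,v)$ is the graph distance; the diameter of $G_k$ is $k$. The neighbors of $u$ in directions North, South, East, West are $u+i$, $u-i$, $u+1$, $u-1$ (mod $\pi$), respectively. Standard one-to-all broadcast from a node $R$: time proceeds in synchronous parallel steps, and in one step a node may send packets to all its neighbors simultaneously. A packet carries the message together with a header consisting of an integer field ''distance'' and a set $D\subseteq\{\mathrm N,\mathrm S,\mathrm E,\mathrm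 W\}$ of directions. At the beginning $R$ holds a packet with distance $=k$ and $D=\{\mathrm N,\mathrm S,\mathrm E,\mathrm W\}$. A non-faulty node holding a packet with header $(\delta,D)$ does nothing further with it if $\delta=0$; if $\delta>0$, then in the next step, for each direction $X\in D$, it sends to its neighbor in direction $X$ a packet with header $(\delta-1,\,D\cap M_X)$, where $M_{\mathrm N}=\{\mathrm N,\mathrm E\}$, $M_{\mathrm S}=\{\mathrm S,\mathrm W\}$, $M_{\mathrm E}=\{\mathrm S,\mathrm E\}$, $M_{\mathrm W}=\{\mathrm N,\mathrm W\}$. A faulty node may receive packets but never forwards any. The set of faulty nodes is fixed and known before the broadcast and does not change during it. In the relocation phase the message travels one edge per step along a shortest path. *)

(* Defs.v *)
From HB Require Import structures.
From mathcomp Require Import all_boot all_order all_algebra.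
From mathcomp Require Import boolp complex.
From mathcomp Require Import ring.

Set Implicit Arguments.
Unset Strict Implicit.
Unset Printing Implicit Defensive.

Import GRing.Theory.
Local Open Scope ring_scope.
Local Open Scope complex_scope.
Local Open Scope quotient_scope.

(* The library makes R[i] a ring only when R is a field; this alias carries   *)
(* the ring structure of Z[i], with the same addition and multiplication.     *)
Definition gaussInt : Type := int[i].

HB.instance Definition _ := GRing.Zmodule.copy gaussInt int[i].
HB.instance Definition _ := Countable.copy gaussInt int[i].

Fact gaussInt_mul1 : left_id (1 +i* 0 : gaussInt) (@ComplexField.mulc int).
Proof. by case=> a b /=; rewrite !mul1r !mul0r subr0 addr0. Qed.

Fact gaussInt_mulDl :
  left_distributive (@ComplexField.mulc int : gaussInt -> gaussInt -> gaussInt)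
    +%R.
Proof. by move=> [a b] [c d] [e f] /=; congr (_ +i* _); ring. Qed.

Fact gaussInt_1neq0 : (1 +i* 0 : gaussInt) != 0.
Proof. by []. Qed.

HB.instance Definition _ := GRing.Zmodule_isComNzRing.Build gaussInt
  (@ComplexField.mulcA int) (@ComplexField.mulcC int)
  gaussInt_mul1 gaussInt_mulDl gaussInt_1neq0.

Definition gi : gaussInt := 'i.

Definition gpi (k : nat) : gaussInt := k%:Z +i* (k.+1)%:Z.

Definition gideal (k : nat) : {pred gaussInt} :=
  fun z => `[< exists q : gaussInt, z = gpi k * q >].

Lemma gidealP k z : reflect (exists q, z = gpi k * q) (z \in gideal k).
Proof. exact: asboolP. Qed.

Fact gideal_zmod_closed k : zmod_closed (gideal k).
Proof.
split; first by apply/gidealP; exists 0; rewrite mulr0.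
move=> x y /gidealP[a ->] /gidealP[b ->].
by apply/gidealP; exists (a - b); rewrite mulrBr.
Qed.

HB.instance Definition _ k :=
  GRing.isZmodClosed.Build gaussInt (gideal k) (gideal_zmod_closed k).

Definition node (k : nat) : Type := {ideal_quot (gideal k)}.

HB.instance Definition _ k := ZmodQuotient.on (node k).
HB.instance Definition _ k : isCountable (node k) :=
  CanIsCountable (@reprK _ (node k)).

Definition residue k (z : gaussInt) : node k := \pi_(node k) z.

Lemma residueD k : {morph @residue k : x y / x + y}.
Proof. by move=> x y; rewrite /residue [LHS]raddfD. Qed.

Lemma eq_residue k x y :
  reflect (exists q, x - y = gpi k * q) (residue k x == residue k y).
Proof.
apply: (iffP idP) => [|h].
  by rewrite /residue -Quotient.idealrBE => /gidealP.
by rewrite /residue -Quotient.idealrBE; apply/gidealP.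
Qed.


Lemma residueP k (u : node k) : exists z, u = residue k z.
Proof. by exists (repr u); rewrite /residue reprK. Qed.

Definition node_enum k : seq (node k) :=
  let n := (k ^ 2 + k.+1 ^ 2)%N in
  undup [seq residue k ((a : nat)%:Z +i* (b : nat)%:Z)
        | a <- iota 0 n, b <- iota 0 n].

Fact node_enumP k : Finite.axiom (node_enum k).
Proof.
apply: Finite.uniq_enumP; first exact: undup_uniq.
move=> u; rewrite mem_undup; have [[x y] ->] := residueP u.
set n := (k ^ 2 + k.+1 ^ 2)%N.
have n_gt0 : (0 < n)%N by rewrite addn_gt0 expn_gt0 orbT.
have nZ : n%:Z != 0 by rewrite eqz_nat -lt0n.
have ex (m : int) : exists2 a : nat, a \in iota 0 n & (m %% n)%Z = a%:Z.
  have := modz_ge0 m nZ; have := @ltz_pmod m n%:Z; rewrite ltz_nat n_gt0.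
  case: (m %% n)%Z => // a /(_ isT) lt_an _.
  by exists a; rewrite // mem_iota.
have [a a_n xa] := ex x; have [b b_n yb] := ex y.
apply/allpairsP; exists (a, b); split=> //=.
apply/eqP/eq_residue.
exists ((k%:Z -i* (k.+1)%:Z : gaussInt) * ((x %/ n)%Z +i* (y %/ n)%Z)).
rewrite {1}(divz_eq x n) {1}(divz_eq y n) xa yb mulrA.
have -> : gpi k * (k%:Z -i* (k.+1)%:Z : gaussInt) = n%:Z +i* 0.
  rewrite /n PoszD !expnS !expn0 !muln1 !PoszM.
  by congr (_ +i* _); ring.
by congr (_ +i* _); ring.
Qed.

HB.instance Definition _ k := isFinite.Build (node k) (@node_enumP k).

Variant direction := North | South | East | West.

Definition bool_of_direction (X : direction) : bool * bool :=
  match X with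
  | North => (true, true) | South => (true, false)
  | East => (false, true) | West => (false, false)
  end.

Definition direction_of_bool (b : bool * bool) : direction :=
  match b with
  | (true, true) => North | (true, false) => South
  | (false, true) => East | (false, false) => West
  end.

Fact bool_of_directionK : cancel bool_of_direction direction_of_bool.
Proof. by case. Qed.

HB.instance Definition _ :=
  Finite.copy direction (can_type bool_of_directionK).

Definition direction_vec (X : direction) : gaussInt :=
  match X with
  | North => gi
  | South => - gi
  | East => 1
  | West => -1
  end.

Definition neighbor k (u : node k) (X : direction) : node k :=
  u + residue k (direction_vec X).

Definition adj k : rel (node k) := fun u v =>
  v - u \in [:: residue k 1; residue k (-1); residue k gi; residue k (- gi)].

Lemma adj_neighbor k (u : node k) X : adj u (neighbor u X).
Proof.
rewrite /adj /neighbor addrC addrA addNr add0r.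
by case: X; rewrite !inE eqxx ?orbT.
Qed.

Definition walk k (n : nat) (u v : node k) : bool :=
  [exists p : n.-tuple (node k), path (@adj k) u p && (last u p == v)].

Fact walk_exists k (u v : node k) : exists n, walk n u v.
Proof.
pose P z := forall w : node k, connect (@adj k) w (w + residue k z).
have P0 : P 0 by move=> w; rewrite /residue raddf0 addr0 connect0.
have PD z1 z2 : P z1 -> P z2 -> P (z1 + z2).
  by move=> P1 P2 w; rewrite residueD addrA; apply: connect_trans (P2 _).
have Pn z n : P z -> P (z *+ n).
  by move=> Pz; elim: n => [|n IHn]; rewrite ?mulr0n // mulrS; apply: PD.
have PX X : P (direction_vec X).
  by move=> w; apply: connect1; apply: adj_neighbor.
have PZ (z : gaussInt) (m : int) : P z -> P (- z) -> P (z *~ m).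
  move=> Pz PNz; case: m => n; first exact: Pn.
  by rewrite NegzE mulrNz -mulNrz; apply: Pn.
have PG (z : gaussInt) : P z.
  case: z => x y.
  have -> : (x +i* y : gaussInt) = 1 *~ x + gi *~ y.
    have E (a b m : int) : (a +i* b : gaussInt) *~ m = (a * m) +i* (b * m).
      have En (n : nat) : (a +i* b : gaussInt) *+ n = (a *+ n) +i* (b *+ n).
        by elim: n => [|n IHn]; rewrite ?mulr0n // !mulrS IHn.
      have Em (c : int) n : c * n%:Z = c *+ n by rewrite -mulr_natr natz.
      case: m => n; first by rewrite -pmulrn En !Em.
      by rewrite NegzE mulrNz -pmulrn En !mulrN !Em.
    rewrite (E 1 0) (E 0 1) !mul1r !mul0r.
    by congr (_ +i* _); rewrite ?addr0 ?add0r.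
  apply: PD; apply: PZ; [exact: (PX East)|exact: (PX West)|
                         exact: (PX North)|exact: (PX South)].
have [z vuz] := residueP (v - u).
have /connectP[p pP pv] := PG z u.
exists (size p); apply/existsP; exists (in_tuple p).
by rewrite pP -pv -vuz addrC subrK eqxx.
Qed.

Definition dist k (u v : node k) : nat := ex_minn (walk_exists u v).

Definition shortest_path k (u v : node k) (p : seq (node k)) : Prop :=
  [/\ path (@adj k) u p, last u p = v & size p = dist u v].

(* Internal nodes of the path u :: p, whose end points are u and last u p. *)
Definition internal k (u : node k) (p : seq (node k)) : seq (node k) :=
  behead (belast u p).

Definition dirmask (X : direction) : {set direction} :=
  match X with
  | North => [set North; East]
  | South => [set South; West]
  | East => [set South; East]
  | West => [set North; West]
  end.

(* [packet F R t u delta D]: in the broadcast from R, u holds after t steps a *)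
(* packet with distance field delta and direction set D.                      *)
Inductive packet k (F : {set node k}) (R : node k) :
    nat -> node k -> nat -> {set direction} -> Prop :=
| packet_init : packet F R 0 R k [set: direction]
| packet_send t u delta D X :
    packet F R t u delta D -> u \notin F -> (0 < delta)%N -> X \in D ->
    packet F R t.+1 (neighbor u X) delta.-1 (D :&: dirmask X).

Definition broadcast_reaches k (F : {set node k}) (R : node k) (t : nat)
    (u : node k) : Prop :=
  exists delta D, packet F R t u delta D.

(* [relocation F S p t u]: a message sent from S along the path S :: p is at  *)
(* u after t steps.  As in the broadcast, a faulty node does not forward it.  *)
Inductive relocation k (F : {set node k}) (S : node k) (p : seq (node k)) :
    nat -> node k -> Prop :=
| relocation_init : relocation F S p 0 S
| relocation_send t u :
    relocation F S p t u -> u \notin F -> (t < size p)%N ->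
    relocation F S p t.+1 (nth S p t).

(* The broadcast starts from the end of the path, when and only if the        *)
(* message has arrived there.                                                 *)
Inductive rerooted_reaches k (F : {set node k}) (S : node k)
    (p : seq (node k)) : nat -> node k -> Prop :=
| rerooted_relocation t u :
    relocation F S p t u -> rerooted_reaches F S p t u
| rerooted_broadcast t u :
    relocation F S p (size p) (last S p) ->
    broadcast_reaches F (last S p) t u ->
    rerooted_reaches F S p (size p + t) u.

(* Main.v *)
Require Import Defs.
From mathcomp Require Import all_boot.
From mathcomp Require Import all_order all_algebra complex ring zify.

(** Write |x| + |y| for the Lee norm of x + y i.  The Lee ball of radius k
    contains exactly one representative of each class modulo k + (k + 1) i: it
    meets every class because the norm k + 1 elements can be shifted into it by
    a unit multiple of k + (k + 1) i, and it meets no class twice because a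
    nonzero multiple of k + (k + 1) i has Lee norm at least 2 k + 1.  Hence
    d(u, u + z) is the Lee norm of z for z in the ball.  A common antipode of
    two nodes is then found by an explicit choice in one quadrant, carried to
    the others by multiplication by i.

    The broadcast from R reaches R + z by going straight in some direction and
    then turning right at most once, along nodes at distance less than k
    from R until the last one.  If all faults are at distance exactly k from R,
    none of them is a node that has to forward.  Likewise the internal nodes of
    a shortest path to R are at distance less than k from R. *)

Section DenseGaussianNetwork.

Set Implicit Arguments.
Unset Strict Implicit.

Import Order.TTheory GRing.Theory Num.Theory.
Local Open Scope ring_scope.
Local Open Scope complex_scope.

(** * The Lee norm on the Gaussian integers *)

Definition lee (z : gaussInt) : nat := (absz (complex.Re z) + absz (complex.Im z))%N.

Lemma gaussIntD (a b c d : int) :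
  (a +i* b : gaussInt) + (c +i* d : gaussInt) = (a + c) +i* (b + d).
Proof. by []. Qed.

Lemma gaussIntN (a b : int) : - (a +i* b : gaussInt) = (- a) +i* (- b).
Proof. by []. Qed.

Lemma gaussIntM (a b c d : int) :
  (a +i* b : gaussInt) * (c +i* d : gaussInt) = (a * c - b * d) +i* (a * d + b * c).
Proof. by []. Qed.

Lemma gaussIntMn (a b : int) n : (a +i* b : gaussInt) *+ n = (a *+ n) +i* (b *+ n).
Proof. by elim: n => [|n IHn]; rewrite ?mulr0n // !mulrS IHn. Qed.

Lemma gaussInt1Mn n : (1 : gaussInt) *+ n = n%:Z +i* 0.
Proof. by rewrite gaussIntMn mul0rn natz. Qed.

Lemma giMn n : gi *+ n = 0 +i* n%:Z.
Proof. by rewrite gaussIntMn mul0rn natz. Qed.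

Lemma lee_eq0 z : (lee z == 0%N) = (z == 0).
Proof.
case: z => a b; rewrite /lee /=; apply/idP/eqP => [h | [-> ->] //].
by congr (_ +i* _); lia.
Qed.

Lemma leeN z : lee (- z) = lee z.
Proof. by case: z => a b; rewrite /lee /= !abszN. Qed.

Lemma leeD x y : (lee (x + y)%R <= lee x + lee y)%N.
Proof. by case: x y => [a b] [c d]; rewrite gaussIntD /lee /=; lia. Qed.

Lemma lee_gi z : lee (gi * z) = lee z.
Proof. by case: z => a b; rewrite gaussIntM /lee /=; lia. Qed.

Lemma lee_direction_vec X : lee (direction_vec X) = 1%N.
Proof. by case: X. Qed.

(* |x| + |y| = max (|x + y|, |x - y|), and the coordinates x + y and y - x of *)
(* (k + (k + 1) i) (a + b i) are (2k + 1) a - b and a + (2k + 1) b.           *)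
Lemma lee_ideal k q : q != 0 -> (2 * k + 1 <= lee (gpi k * q)%R)%N.
Proof.
rewrite -lee_eq0; case: q => a b; rewrite gaussIntM /lee /= => h.
set x := _ - _; set y := _ + _.
have e1 : x + y = (2 * k%:Z + 1) * a - b by rewrite /x /y intS; ring.
have e2 : y - x = (2 * k%:Z + 1) * b + a by rewrite /x /y intS; ring.
move: x y e1 e2 => x y e1 e2.
(* If [a] or [b] vanishes, one of the two coordinates is a nonzero multiple of 2k + 1. Otherwise the
   two terms of [y - x] (for ab > 0) or of [x + y] (for ab < 0) have the same sign and cannot
   cancel. *)
have [a0|[b0|[ab|ab]]] : a = 0 \/ b = 0 \/ 0 < a * b \/ a * b < 0 by nia.
- subst a; have : `|b| >= 1 by lia. nia.
- subst b; have : `|a| >= 1 by lia. nia.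
- nia.
- nia.
Qed.

(** * Residue classes, walks and distances *)

Section Network.

Variable k : nat.
Implicit Types (u v w : node k) (x y z : gaussInt).

Lemma residue0 : residue k 0 = 0.
Proof. by apply/(addrI (residue k 0)); rewrite -residueD !addr0. Qed.

Lemma residueN z : residue k (- z) = - residue k z.
Proof. by apply/(addrI (residue k z)); rewrite -residueD !subrr residue0. Qed.

Lemma residue_gpiM z q : residue k (z + gpi k * q) = residue k z.
Proof. by apply/eqP/eq_residue; exists q; rewrite addrC addKr. Qed.

Lemma residueM x y z : residue k x = residue k y -> residue k (z * x) = residue k (z * y).
Proof.
by move/eqP/eq_residue=> [q e]; apply/eqP/eq_residue; exists (z * q); rewrite -mulrBr e mulrCA.
Qed.

Lemma adjP u v : reflect (exists X, v = neighbor u X) (adj u v).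
Proof.
apply: (iffP idP) => [|[X ->]]; last exact: adj_neighbor.
have nb z : v - u = residue k z -> v = u + residue k z.
  by move=> <-; rewrite addrC subrK.
rewrite /adj !inE => /or4P[] /eqP/nb ->.
- by exists East.
- by exists West.
- by exists North.
- by exists South.
Qed.

Lemma adj_sym u v : adj u v = adj v u.
Proof.
suff s u' v' : adj u' v' -> adj v' u' by apply/idP/idP; apply: s.
case/adjP=> X ->; apply/adjP.
exists (match X with North => South | South => North | East => West | West => East end).
by rewrite /neighbor -addrA -residueD; case: X; rewrite ?subrr ?addNr residue0 addr0.
Qed.

Lemma walkP n u v :
  reflect (exists p, [/\ path (@adj k) u p, last u p = v & size p = n]) (walk n u v).
Proof.
apply: (iffP existsP) => [[p /andP[pP /eqP pv]] | [p [pP pv /eqP pn]]].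
  by exists p; rewrite size_tuple.
by exists (Tuple pn); rewrite /= pP pv eqxx.
Qed.

Lemma walk_dist u v : walk (dist u v) u v.
Proof. by rewrite /dist; case: ex_minnP. Qed.

Lemma dist_le_walk n u v : walk n u v -> (dist u v <= n)%N.
Proof. by rewrite /dist; case: ex_minnP => m _ h /h. Qed.

Lemma walk_sym n u v : walk n u v -> walk n v u.
Proof.
move=> /walkP[p [pP pv pn]]; apply/walkP; exists (rev (belast u p)).
rewrite -pv rev_path size_rev size_belast; split=> //.
  by rewrite (eq_path (e' := @adj k)) // => a b; rewrite adj_sym.
by case: p {pP pv pn} => //= a p; rewrite rev_cons last_rcons.
Qed.

(** If x >= 0, y > 0 and x + y = k + 1, then subtracting [gpi k] gives the norm (k - x) + (k + 1 -
    y) = k. The other half-open quadrants are rotations of this one. *)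
Lemma lee_gpi_step z : lee z = k.+1 -> exists2 y, residue k y = residue k z & (lee y <= k)%N.
Proof.
case: z => x y; rewrite /lee /= => h.
have shift (q : gaussInt) :
    (lee ((x +i* y : gaussInt) + gpi k * q)%R <= k)%N ->
  exists2 y0, residue k y0 = residue k (x +i* y) & (lee y0 <= k)%N.
  by exists ((x +i* y : gaussInt) + gpi k * q); rewrite ?residue_gpiM.
have [c|[c|[c|c]]] : 0 <= x /\ 0 < y \/ x < 0 /\ 0 <= y \/ x <= 0 /\ y < 0 \/ 0 < x /\ y <= 0.
- by lia.
- by apply: (shift (-1 +i* 0)); rewrite gaussIntM gaussIntD /lee /=; lia.
- by apply: (shift (0 +i* -1)); rewrite gaussIntM gaussIntD /lee /=; lia.
- by apply: (shift (1 +i* 0)); rewrite gaussIntM gaussIntD /lee /=; lia.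
- by apply: (shift (0 +i* 1)); rewrite gaussIntM gaussIntD /lee /=; lia.
Qed.

(** The representative of the displacement is kept in the ball, being exchanged whenever a step
    raises its norm to k + 1. The bound k shows that the ball meets every class; the bound [size p]
    gives the lower bound on distances. *)
Lemma path_lee u p : path (@adj k) u p ->
  exists2 z, last u p = u + residue k z & (lee z <= minn k (size p))%N.
Proof.
elim/last_ind: p => [|p v IHp]; first by exists 0; rewrite ?residue0 ?addr0.
rewrite rcons_path last_rcons size_rcons => /andP[/IHp[z -> zp] /adjP[X ->]].
have := leeD z (direction_vec X); rewrite lee_direction_vec.
rewrite /neighbor -addrA -residueD; set z1 := z + _ => z1z.
have [z1k|z1k] := leqP (lee z1) k; first by exists z1 => //; lia.
have [|y <- yk] := @lee_gpi_step z1; first by lia.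
by exists y => //; lia.
Qed.

Lemma residue_lee w : exists2 z, w = residue k z & (lee z <= k)%N.
Proof.
have /walkP[p [/path_lee[z e zp] p0 _]] := walk_dist 0 w.
by exists z; [rewrite -p0 e add0r | lia].
Qed.

Lemma walk_residue u z : walk (lee z) u (u + residue k z).
Proof.
move e: (lee z) => n; elim: n z e => [|n IHn] z e.
  move/eqP: e; rewrite lee_eq0 => /eqP ->; rewrite residue0 addr0.
  by apply/walkP; exists [::].
have [X zX] : exists X, lee (z - direction_vec X) = n.
  case: z e => a b; rewrite /lee /= => e.
  have [c|[c|[c|c]]] : 0 < a \/ a < 0 \/ 0 < b \/ b < 0 by lia.
  - by exists East; rewrite /=; lia.
  - by exists West; rewrite /=; lia.
  - by exists North; rewrite /=; lia.
  - by exists South; rewrite /=; lia.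
have /walkP[p [pP pl pn]] := IHn _ zX; apply/walkP; exists (rcons p (u + residue k z)).
rewrite rcons_path pP last_rcons size_rcons pn; split=> //=; apply/adjP; exists X.
by rewrite pl /neighbor -addrA -residueD subrK.
Qed.

Lemma dist_residue_le u z : (dist u (u + residue k z)%R <= lee z)%N.
Proof. exact/dist_le_walk/walk_residue. Qed.

Lemma dist_residue u z : (lee z <= k)%N -> dist u (u + residue k z) = lee z.
Proof.
move=> zk; apply/eqP; rewrite eqn_leq dist_residue_le /=.
have /walkP[p [/path_lee[y py yp] pl pn]] := walk_dist u (u + residue k z).
have /esym/eqP/eq_residue[q e] : residue k z = residue k y by apply: (addrI u); rewrite -pl.
(* Both [y] and [z] lie in the ball, so their difference has norm at most 2k, which forces [q] to be
   0. *)
have [q0|q0] := eqVneq q 0; last first.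
  have h := lee_ideal k q0; rewrite -e in h.
  by have := leq_trans h (leeD _ _); rewrite leeN; lia.
by move: e yp; rewrite q0 mulr0 => /subr0_eq ->; rewrite pn; lia.
Qed.

Lemma dist_le_diameter u v : (dist u v <= k)%N.
Proof.
have [z e zk] := residue_lee (v - u).
by rewrite -[v](subrKC u) e dist_residue.
Qed.

(** * Nodes at distance k from two given nodes *)

(** For z = v - u, the node u + x = v + y is at distance k from both [u] and [v]. *)
Definition spheres_meet z :=
  exists x y, [/\ lee x = k, lee y = k & residue k (x - y) = residue k z].

Lemma spheres_meet_gi z : spheres_meet z -> spheres_meet (gi * z).
Proof.
move=> [x [y [xk yk e]]]; exists (gi * x), (gi * y).
by rewrite !lee_gi -mulrBr; split=> //; apply: residueM.
Qed.

Lemma spheres_meet_quadrant (a b : int) :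
  0 <= a -> 0 <= b -> (absz a + absz b <= k)%N -> spheres_meet (a +i* b).
Proof.
move=> a0 b0 ab.
have meet (c d r s : int) :
    (absz c + absz d = k)%N ->
    lee ((c +i* d : gaussInt) - (a +i* b : gaussInt) + gpi k * (r +i* s : gaussInt)) = k ->
  spheres_meet (a +i* b).
  move=> cd h.
  exists (c +i* d), ((c +i* d : gaussInt) - (a +i* b : gaussInt) + gpi k * (r +i* s : gaussInt)).
  by split=> //; rewrite opprD opprB addrA addrCA subrr addr0 -mulrN residue_gpiM.
have shape (m : nat) : (m = m./2.*2 + odd m)%N by rewrite -[LHS]odd_double_half addnC.
(* Modulo 2, the norm of x - y is the sum of the norms of x and y, here 2k. Hence x - y = z is
   possible only for even a + b; for odd a + b the witnesses wrap around by a multiple of [gpi k] of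
   odd norm 2k + 1. *)
have := shape (absz a + absz b)%N; set m := _./2; case: odd => e; have [c|c] := lerP a b.
- by apply: (meet (m%:Z + 1) (m%:Z + 1 - k%:Z) 0 1); rewrite ?gaussIntN ?gaussIntM ?gaussIntD /lee /=; lia.
- by apply: (meet (m%:Z - k%:Z) m%:Z 0 (-1)); rewrite ?gaussIntN ?gaussIntM ?gaussIntD /lee /=; lia.
- by apply: (meet (k%:Z - m%:Z + a) (m%:Z - a) 0 0); rewrite ?gaussIntN ?gaussIntM ?gaussIntD /lee /=; lia.
- by apply: (meet (m%:Z - b) (k%:Z - m%:Z + b) 0 0); rewrite ?gaussIntN ?gaussIntM ?gaussIntD /lee /=; lia.
Qed.

Lemma spheres_meet_all z : (lee z <= k)%N -> spheres_meet z.
Proof.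
have rot (a b : int) : (a +i* b : gaussInt) = gi * (b +i* - a : gaussInt).
  by rewrite gaussIntM /=; congr (_ +i* _); ring.
case: z => a b; rewrite /lee /= => h.
have [a0|a0] := lerP 0 a; have [b0|b0] := lerP 0 b.
- exact: spheres_meet_quadrant.
- do 3 rewrite rot; do 3 apply: spheres_meet_gi; apply: spheres_meet_quadrant; lia.
- do 1 rewrite rot; do 1 apply: spheres_meet_gi; apply: spheres_meet_quadrant; lia.
- do 2 rewrite rot; do 2 apply: spheres_meet_gi; apply: spheres_meet_quadrant; lia.
Qed.

Lemma common_antipode u v : exists w, dist w u = k /\ dist w v = k.
Proof.
have [z e zk] := residue_lee (v - u).
have [x [y [xk yk xy]]] := spheres_meet_all zk.
have d t r : lee r = k -> dist (t + residue k r) t = k.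
  move=> rk; rewrite -[X in dist _ X](addrK (residue k r)) -residueN dist_residue leeN ?rk //.
exists (u + residue k x); split; first exact: d.
have -> : u + residue k x = v + residue k y; last exact: d.
by rewrite -(subrK u v) e -xy residueD residueN [_ + u]addrC -!addrA addNr addr0.
Qed.

(** The part of the path after [w] leads to [v] and misses at least the first edge. *)
Lemma shortest_internal_dist u v p w :
  shortest_path u v p -> w \in internal u p -> (dist v w < dist u v)%N.
Proof.
move=> [pP pv <-]; rewrite /internal.
case: p pP pv => //= a p pP pv wp.
have := lastI a p; rewrite pv; case/splitPr: wp => p1 p2 pE.
have : path (@adj k) u (a :: p) by [].
rewrite -[(size p).+1]/(size (a :: p)) pE rcons_cat rcons_cons cat_path.
rewrite size_cat /= size_rcons => /and3P[_ _ p2P].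
suff /walk_sym/dist_le_walk/leq_ltn_trans : walk (size p2).+1 w v.
  by apply; rewrite addnS ltnS leq_addl.
by apply/walkP; exists (rcons p2 v); rewrite size_rcons last_rcons.
Qed.

(** * The one-to-all broadcast *)

Section Broadcast.

Variables (F : {set node k}) (R : node k).
Hypothesis clear : forall z, (lee z < k)%N -> R + residue k z \notin F.

Definition turn X :=
  match X with North => East | East => South | South => West | West => North end.

Lemma dirmaskE X : dirmask X = [set X; turn X].
Proof. by case: X => //; rewrite setUC. Qed.

Lemma lee_corner X n m :
  lee (direction_vec X *+ n + direction_vec (turn X) *+ m) = (n + m)%N.
Proof.
by case: X; rewrite /= ?mulNrn ?gaussInt1Mn ?giMn ?gaussIntN gaussIntD /lee /=; lia.
Qed.

(** The quadrants are half-open so that the first leg is never empty, while the second may be. *)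
Lemma corner_decomposition z : z != 0 ->
  exists X n m, z = direction_vec X *+ n.+1 + direction_vec (turn X) *+ m.
Proof.
rewrite -lee_eq0; case: z => a b; rewrite /lee /= => h.
have [c|[c|[c|c]]] : 0 <= a /\ 0 < b \/ a < 0 /\ 0 <= b \/ a <= 0 /\ b < 0 \/ 0 < a /\ b <= 0.
- by lia.
- exists North, (absz b).-1, (absz a).
  by rewrite /= ?mulNrn ?gaussInt1Mn ?giMn ?gaussIntN gaussIntD; congr (_ +i* _); lia.
- exists West, (absz a).-1, (absz b).
  by rewrite /= ?mulNrn ?gaussInt1Mn ?giMn ?gaussIntN gaussIntD; congr (_ +i* _); lia.
- exists South, (absz b).-1, (absz a).
  by rewrite /= ?mulNrn ?gaussInt1Mn ?giMn ?gaussIntN gaussIntD; congr (_ +i* _); lia.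
- exists East, (absz a).-1, (absz b).
  by rewrite /= ?mulNrn ?gaussInt1Mn ?giMn ?gaussIntN gaussIntD; congr (_ +i* _); lia.
Qed.

(** The count starts at one because the packet of the root carries all four directions; from the
    first send on, the set stays [dirmask X]. *)
Lemma packet_first_leg X n : (n < k)%N ->
  packet F R n.+1 (R + residue k (direction_vec X *+ n.+1)) (k - n.+1) (dirmask X).
Proof.
elim: n => [|n IHn] nk.
  have /clear : (lee 0%R < k)%N by [].
  rewrite residue0 addr0 mulr1n subn1 => RF.
  have := @packet_send k F R _ _ _ _ X (@packet_init k F R) RF nk (in_setT _).
  by rewrite setTI.
have nk' := ltnW nk.
have lee_n : lee (direction_vec X *+ n.+1) = n.+1.
  by have := lee_corner X n.+1 0; rewrite mulr0n addr0 addn0.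
have := packet_send (IHn nk') (clear _) _ (_ : X \in dirmask X).
rewrite lee_n setIid /neighbor -addrA -residueD -mulrSr -subnS; apply=> //.
  by rewrite subn_gt0.
by rewrite dirmaskE !inE eqxx.
Qed.

(** The set [D] shrinks at the turn, from [dirmask X] to [turn X] alone; the next send only needs
    that it contains [turn X]. *)
Lemma packet_second_leg X n m : (n.+1 + m <= k)%N ->
  exists2 D : {set direction}, turn X \in D &
    packet F R (n.+1 + m)
      (R + residue k (direction_vec X *+ n.+1 + direction_vec (turn X) *+ m))
      (k - (n.+1 + m)) D.
Proof.
elim: m => [|m IHm] nk.
  rewrite mulr0n addr0 addn0; exists (dirmask X); first by rewrite dirmaskE !inE eqxx orbT.
  by apply: packet_first_leg; rewrite addn0 in nk.
rewrite addnS in nk *; have [D tD pD] := IHm (ltnW nk).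
exists (D :&: dirmask (turn X)); first by rewrite inE tD dirmaskE !inE eqxx.
have := packet_send pD (clear _) _ tD.
rewrite lee_corner /neighbor -!addrA -residueD -!addrA -mulrSr -subnS; apply=> //.
by rewrite subn_gt0.
Qed.

Lemma broadcast_reaches_all u : exists2 t, (t <= k)%N & broadcast_reaches F R t u.
Proof.
have [z e zk] := residue_lee (u - R).
have -> : u = R + residue k z by rewrite -e subrKC.
have [->|] := eqVneq z 0.
  by exists 0%N; rewrite // residue0 addr0; exists k, setT; apply: packet_init.
move=> /corner_decomposition[X [n [m zE]]].
move: zk; rewrite zE lee_corner => zk; exists (n.+1 + m)%N => //.
by have [D _ pD] := packet_second_leg X zk; exists (k - (n.+1 + m))%N, D.
Qed.

End Broadcast.

Lemma relocation_path (F : {set node k}) S p t :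
  S \notin F -> {in internal S p, forall f, f \notin F} -> (t <= size p)%N ->
  relocation F S p t (nth S (S :: p) t).
Proof.
move=> SF pF; elim: t => [|t IHt] tp; first exact: relocation_init.
apply: relocation_send (IHt (ltnW tp)) _ (tp).
(* The forwarding node is [S] at time 0 and an internal node of the path at later times below
   [size p]. *)
case: t {IHt} tp => [//|t]; rewrite /internal in pF.
case: p pF => //= a p pF tp; apply: pF.
rewrite (lastI a p) nth_rcons size_belast (_ : t < size p)%N //.
by apply: mem_nth; rewrite size_belast.
Qed.

End Network.

End DenseGaussianNetwork.

Theorem mainTheorem3 (k : nat) (hk : 1 <= k) (S : node k) (F : {set node k})
    (hF : 1 <= #|F| <= 2) (hS : S \notin F) :
  (exists NS : node k, forall f, f \in F -> dist NS f = k) /\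
  (forall NS : node k, (forall f, f \in F -> dist NS f = k) ->
    [/\ (* (i) *)
        [/\ forall f p, f \in F -> shortest_path S NS p -> f \notin internal S p,
            dist S NS <= k
          & forall p, shortest_path S NS p ->
              size p <= k /\ relocation F S p (size p) NS],
        (* (ii) *)
        forall u : node k, u \notin F ->
          exists2 t, t <= k & broadcast_reaches F NS t u
      & (* consequence *)
        forall p, shortest_path S NS p ->
          forall u : node k, u \notin F ->
            exists2 t, t <= 2 * k & rerooted_reaches F S p t u]).
Proof.
split.
  (* A single fault is listed twice. *)
  have [f1 [f2 sF]] : exists f1 f2, forall f, f \in F -> f = f1 \/ f = f2.
    move: hF; rewrite cardE; case e : (enum F) => [|f1 [|f2 [|]]] // _.
      by exists f1, f1 => f; rewrite -mem_enum e !inE => /eqP ->; left.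
    by exists f1, f2 => f; rewrite -mem_enum e !inE => /orP[] /eqP ->; [left|right].
  have [NS [d1 d2]] := common_antipode f1 f2.
  by exists NS => f /sF[] ->.
move=> NS hNS.
have dS := dist_le_diameter S NS.
have intF f p : f \in F -> shortest_path S NS p -> f \notin internal S p.
  move=> fF pP; apply/negP => /(shortest_internal_dist pP).
  by rewrite (hNS _ fF) ltnNge dS.
have reloc p : shortest_path S NS p -> size p <= k /\ relocation F S p (size p) NS.
  move=> pP; have [_ pl ps] := pP; split; first by rewrite ps.
  rewrite -pl (last_nth S); apply: relocation_path => // f fp.
  by apply/negP => fF; have := intF _ _ fF pP; rewrite fp.
have bcast : forall u, exists2 t, t <= k & broadcast_reaches F NS t u.
  (* A fault at a displacement of norm below k would be at distance less than k from [NS]. *)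
  apply: broadcast_reaches_all => z zk; apply/negP => /hNS e.
  by have := dist_residue_le NS z; rewrite e leqNgt zk.
split=> [|u _|p pP u _]; [by split | exact: bcast |].
have [pk rP] := reloc _ pP; have [_ pl _] := pP.
have [t tk tu] := bcast u; exists (size p + t); first by rewrite mul2n -addnn leq_add.
by apply: rerooted_broadcast; rewrite pl.
Qed.
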